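(* Let a (continuous) fibration of $\mathbb R^n$ by oriented affine $k$-planes be given. If the fibration is locally skew, then it is (globally) skew, i.e. no two distinct fibers contain parallel lines.
   Context: A fibration of an open set $T\subset\mathbb R^n$ by oriented affine $k$-planes is a family of pairwise disjoint oriented affine $k$-dimensional planes with union $T$ such that the map $\pi\colon T\to G_k(n)$, sending $x$ to the oriented linear $k$-plane parallel to the fiber through $x$, is continuous, and the map sending $x$ to its fiber (as an element of the affine Grassmannian) is continuous. Two oriented affine $k$-planes are skew if they are disjoint and do not contain parallel lines (i.e. their linear translates intersect only in $0$); a fibration is skew if any two distinct fibers are skew (two distinct fibers never contain parallel lines). A fibration of $\mathbb R^n$ is locally skew if every point of $\mathbb R^n$ has an open neighborhood $N$ such that any two distinct fibers meeting $N$ contain no parallel lines. *)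

(* Defs.v *)
From HB Require Import structures.
From mathcomp Require Import all_boot all_order all_algebra.
From mathcomp Require Import all_classical all_reals all_analysis.
Set Implicit Arguments. Unset Strict Implicit. Unset Printing Implicit Defensive.
Import Order.TTheory GRing.Theory Num.Theory.
Import numFieldNormedType.Exports.
Local Open Scope classical_set_scope.
Local Open Scope ring_scope.

Section Planes.
Variables (R : realType) (n k : nat).

(* An oriented affine k-plane in R^n is presented by a pair (B, p):
   B : 'M_(k, n) a row-free matrix whose rows form an ordered basis of the
   direction (the orientation is the class of this ordered basis), and a
   point p of the plane. *)

Definition pts (B : 'M[R]_(k, n)) (p : 'rV[R]_n) : set 'rV[R]_n :=
  [set p + u *m B | u in [set: 'rV[R]_k]].

(* The k-vector B_1 /\ ... /\ B_k as an alternating tensor: its coordinates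
   are det of the k x k column-submatrices of B, for all f : 'I_k -> 'I_n. *)
Definition kvec (B : 'M[R]_(k, n)) : 'rV[R]_#|{: {ffun 'I_k -> 'I_n}}| :=
  \row_i \det (colsub (fun j => (enum_val i : {ffun 'I_k -> 'I_n}) j) B).

(* The oriented linear k-plane parallel to (B, _), as a point of the oriented
   Grassmannian G_k(n), realized (Pluecker embedding) as the unit k-vector. *)
Definition odir (B : 'M[R]_(k, n)) : 'rV[R]_#|{: {ffun 'I_k -> 'I_n}}| :=
  (Num.sqrt (\sum_i (kvec B 0 i) ^+ 2))^-1 *: kvec B.

(* The foot point: orthogonal projection of the origin onto the plane. *)
Definition foot (B : 'M[R]_(k, n)) (p : 'rV[R]_n) : 'rV[R]_n :=
  p - p *m B^T *m invmx (B *m B^T) *m B.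

Definition same_oplane (B : 'M[R]_(k, n)) p (B' : 'M[R]_(k, n)) p' : Prop :=
  pts B p = pts B' p' /\ odir B = odir B'.

(* A fibration of the open set T by oriented affine k-planes, given by the
   fiber through each x in T, presented as (fB x, fp x). *)
Definition is_fibration (T : set 'rV[R]_n)
    (fB : 'rV[R]_n -> 'M[R]_(k, n)) (fp : 'rV[R]_n -> 'rV[R]_n) : Prop :=
  [/\ open T,
      (forall x, T x -> [/\ row_free (fB x), pts (fB x) (fp x) x &
                            pts (fB x) (fp x) `<=` T]),
      (forall x y, T x -> T y ->
         pts (fB x) (fp x) `&` pts (fB y) (fp y) !=set0 ->
         same_oplane (fB x) (fp x) (fB y) (fp y)),
      {within T, continuous (fun x => odir (fB x))} &
      (* x |-> its fiber in the (oriented) affine Grassmannian is continuous *)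
      {within T, continuous (fun x => foot (fB x) (fp x))}].

Definition no_parallel_lines (B B' : 'M[R]_(k, n)) : Prop :=
  forall v : 'rV[R]_n, (v <= B)%MS -> (v <= B')%MS -> v = 0.

Definition skew_planes (B : 'M[R]_(k, n)) p (B' : 'M[R]_(k, n)) p' : Prop :=
  pts B p `&` pts B' p' = set0 /\ no_parallel_lines B B'.

Definition skew_fibration (T : set 'rV[R]_n)
    (fB : 'rV[R]_n -> 'M[R]_(k, n)) (fp : 'rV[R]_n -> 'rV[R]_n) : Prop :=
  forall x y, T x -> T y -> ~ same_oplane (fB x) (fp x) (fB y) (fp y) ->
    skew_planes (fB x) (fp x) (fB y) (fp y).

Definition locally_skew
    (fB : 'rV[R]_n -> 'M[R]_(k, n)) (fp : 'rV[R]_n -> 'rV[R]_n) : Prop :=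
  forall z : 'rV[R]_n, exists N : set 'rV[R]_n,
    [/\ open N, N z &
        forall x y,
          pts (fB x) (fp x) `&` N !=set0 ->
          pts (fB y) (fp y) `&` N !=set0 ->
          ~ same_oplane (fB x) (fp x) (fB y) (fp y) ->
          no_parallel_lines (fB x) (fB y)].

End Planes.

(* Main.v *)
(* Suppose distinct fibers P, Q through p, q have a common direction v. Fix
   coordinates f transverse to P, and for y near p let Phi_y be the projection
   along the direction of the fiber through p + y onto the vectors whose
   f-coordinates vanish; Phi_y w = 0 iff w is parallel to that fiber. On the
   slice {y : y_f = 0}:
   - Phi_y v = 0 only at y = 0, by local skewness;
   - Phi_y (y + s v) = 0 only at y = 0, since otherwise the fiber through p + y
     meets P at p - s v;
   - Phi_y (v + s (p - q + y)) <> 0 for s <> 0, since otherwise the fiber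
     through p + y meets Q at q - v / s.
   By the first two facts y |-> Phi_y v is homotopic, away from y = 0, to the
   identity; for small s <> 0 the field of the third fact is a small
   perturbation of it near the boundary of a ball, yet it has no zero in the
   ball, contradicting the no-retraction theorem.

   The no-retraction theorem is obtained from a parity version of Sperner's
   lemma for Kuhn's triangulation of a discrete torus. For every labelling of
   the torus the number of panchromatic simplices is even, so two labellings
   that agree along the seam where the cube is glued have the same parity of
   panchromatic simplices off the seam; for the labelling of the identity field
   there is exactly one. *)
Require Import Defs.
From HB Require Import structures.
From mathcomp Require Import all_boot all_order all_algebra all_fingroup.
From mathcomp Require Import zify ring lra.
From mathcomp Require Import all_classical all_reals all_analysis.
Set Implicit Arguments. Unset Strict Implicit. Unset Printing Implicit Defensive.
Import Order.TTheory GRing.Theory Num.Theory.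
Import numFieldNormedType.Exports.
Local Open Scope ring_scope.

(** The orbits of [f] in [A] are pairs; the induction removes one pair at a time. *)
Lemma involution_even (T : finType) (A : {set T}) (f : T -> T) :
  {in A, forall x, [/\ f x \in A, f (f x) = x & f x != x]} -> ~~ odd #|A|.
Proof.
move: {2}#|A|.+1 (ltnSn #|A|) => m; elim: m A => // m IHm A.
rewrite ltnS => leA fA.
have [->|[x xA]] := finset.set_0Vmem A; first by rewrite cards0.
have [fxA ffx fxx] := fA x xA.
have xA' : f x \in A :\ x by rewrite !inE fxx.
have cA := cardsD1 x A; have cA' := cardsD1 (f x) (A :\ x).
rewrite xA add1n in cA; rewrite xA' add1n in cA'.
rewrite cA cA' /= negbK; apply: IHm; first by rewrite -cA' (leq_trans _ leA) // cA.
move=> y; rewrite !inE => /and3P[yfx yx yA].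
have [fyA ffy fyy] := fA y yA; rewrite fyA ffy fyy !andbT; split=> //.
apply/andP; split; first by apply: contra yx => /eqP e; rewrite -ffy e ffx.
by apply: contra yfx => /eqP e; rewrite -ffy e.
Qed.

(** * Sperner's lemma on a discrete torus *)

Section Sperner.
Variables (m N : nat).
Let n := m.+1.
Let torus := {ffun 'I_n -> 'I_N.+1}.
Let pos := 'I_n.+1.
Local Notation flag := ({ffun pos -> torus} * 'S_n.+1)%type.

(* The n unit steps together with -(1, ..., 1): a Kuhn simplex, walked around
   cyclically, uses each of these n + 1 steps once. Zp1 is used because
   'I_N.+1 is only a group for arbitrary N. *)
Definition kstep (a : pos) : torus :=
  [ffun c => if a == lift ord0 c then Zp1 else if a == ord0 then - Zp1 else 0].

(* A simplex is stored with a starting vertex, so its n + 1 rotations are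
   distinct elements; this makes "a simplex with a marked vertex" (the vertex
   at position 0) a single object. *)
Definition ksimplex : {set flag} :=
  [set s : flag | [forall t, s.1 (t + 1) == s.1 t + kstep (s.2 t)]].

Lemma ksimplexP (s : flag) :
  reflect (forall t, s.1 (t + 1) = s.1 t + kstep (s.2 t)) (s \in ksimplex).
Proof. by rewrite inE; apply: (iffP forallP) => H t; apply/eqP/H. Qed.

(** The same closed walk, marked at the vertex that stood at position [t]. *)
Definition krot (t : pos) (s : {ffun pos -> torus} * 'S_n.+1) :=
  ([ffun u => s.1 (u + t)], (perm (addIr t) * s.2)%g).

Lemma krot_simplex t s : s \in ksimplex -> krot t s \in ksimplex.
Proof.
case: s => v sg /ksimplexP/= H; apply/ksimplexP => u.
by rewrite !ffunE permM permE addrAC H.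
Qed.

Lemma krotK t s : krot (- t) (krot t s) = s.
Proof.
case: s => v sg; congr pair; first by apply/ffunP => u; rewrite !ffunE /= subrK.
by apply/permP => u; rewrite !permM !permE subrK.
Qed.

(* The reflected simplex across the facet opposite to the vertex at position 0. *)
Definition kflip (s : {ffun pos -> torus} * 'S_n.+1) :=
  ([ffun u => if u == 0 then s.1 (-1) + kstep (s.2 0) else s.1 u],
   (tperm (0 : pos) (-1) * s.2)%g).

(** The steps into and out of position 0 are exchanged. Their sum is unchanged, so the walk still
    joins the vertices at positions -1 and 1. *)
Lemma kflip_simplex s : s \in ksimplex -> kflip s \in ksimplex.
Proof.
case: s => v sg /ksimplexP/= H; apply/ksimplexP => u /=; rewrite !ffunE permM /=.
rewrite addr_eq0; have [->|u0] := eqVneq u 0.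
  by rewrite eq_sym oppr_eq0 oner_eq0 tpermL -addrA [kstep _ + _]addrC addrA -H addNr H.
have [->|u1] := eqVneq u (-1); first by rewrite tpermR.
by rewrite tpermD // eq_sym.
Qed.

Lemma kflipK s : s \in ksimplex -> kflip (kflip s) = s.
Proof.
case: s => v sg /ksimplexP/= H; rewrite /kflip /=; congr pair.
  apply/ffunP => u; rewrite !ffunE oppr_eq0 oner_eq0; case: eqP => // ->.
  by rewrite permM tpermL -H addNr.
by rewrite mulgA tperm2 mul1g.
Qed.

Variable lab : torus -> 'I_n.+1.

(** By counting, the facet opposite the marked vertex then shows each label except [ord_max] exactly
    once. *)
Definition kdoor (s : {ffun pos -> torus} * 'S_n.+1) :=
  [forall t : pos, (t != 0) ==> (lab (s.1 t) != ord_max) &&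
    [forall u : pos, (u != 0) ==> (lab (s.1 t) == lab (s.1 u)) ==> (t == u)]].

Lemma kdoorP (s : flag) : reflect
  ((forall t, t != 0 -> lab (s.1 t) != ord_max) /\
   (forall t u, t != 0 -> u != 0 -> lab (s.1 t) = lab (s.1 u) -> t = u))
  (kdoor s).
Proof.
apply: (iffP forallP) => [H|[H1 H2] t]; first split.
- by move=> t t0; have /implyP/(_ t0)/andP[] := H t.
- move=> t u t0 u0 e; have /implyP/(_ t0)/andP[_ /forallP/(_ u)] := H t.
  by rewrite u0 e eqxx /= => /eqP.
- apply/implyP => t0; rewrite H1 //=; apply/forallP => u.
  by apply/implyP => u0; apply/implyP => /eqP e; apply/eqP/H2.
Qed.

(** Marking the vertex labelled [ord_max] selects one of the rotations of each fully labelled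
    simplex. *)
Definition panchromatic :=
  [set s in ksimplex | kdoor s & lab (s.1 0) == ord_max].

Lemma in_panchromatic s :
  s \in panchromatic = [&& s \in ksimplex, kdoor s & lab (s.1 0) == ord_max].
Proof. by rewrite finset.in_set. Qed.

Let twin (s : {ffun pos -> torus} * 'S_n.+1) : pos :=
  odflt 0 [pick t | (t != 0) && (lab (s.1 t) == lab (s.1 0))].

(** Without a twin all labels would be distinct, hence all would occur, but [ord_max] does not. *)
Let twinP s : kdoor s -> lab (s.1 0) != ord_max ->
  twin s != 0 /\ lab (s.1 (twin s)) = lab (s.1 0).
Proof.
move=> /kdoorP[D1 D2] s0; rewrite /twin; case: pickP => [t /andP[t0 /eqP]//|H].
have inj : injective (fun t => lab (s.1 t)).
  move=> t u e; have [t0|t0] := eqVneq t 0; have [u0|u0] := eqVneq u 0.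
  - by rewrite t0.
  - by have := H u; rewrite u0 -e t0 eqxx.
  - by have := H t; rewrite t0 e u0 eqxx.
  - exact: D2.
have [g _ gK] := injF_bij inj.
have := gK ord_max; have [->|g0] := eqVneq (g ord_max) 0; first by move/eqP; rewrite (negPf s0).
by move/eqP; rewrite (negPf (D1 _ g0)).
Qed.

Lemma kdoor_flip s : kdoor s -> kdoor (kflip s).
Proof.
move=> /kdoorP[D1 D2]; apply/kdoorP; split=> [t|t u] t0 => [|u0].
  by rewrite ffunE (negPf t0); apply: D1.
by rewrite !ffunE (negPf t0) (negPf u0); apply: D2.
Qed.

Lemma kflip_neq s : kflip s != s.
Proof.
apply/eqP => /(congr1 (fun x : flag => x.2 (0 : pos))); rewrite permM tpermL => /perm_inj/eqP.
by rewrite oppr_eq0 oner_eq0.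
Qed.

(** The vertices at positions 0 and [t] share a label, so the facets opposite them show the same
    labels. *)
Lemma kdoor_rot s t : kdoor s -> t != 0 -> lab (s.1 0) != ord_max ->
  lab (s.1 t) = lab (s.1 0) -> kdoor (krot t s).
Proof.
move=> /kdoorP[D1 D2] t0 s0 st.
have tE u : u != 0 -> u + t != t.
  by apply: contra => /eqP e; rewrite -(addrK t u) e subrr.
have Dt u : u + t = 0 -> forall w, w != 0 -> lab (s.1 (u + t)) = lab (s.1 (w + t)) -> u = w.
  move=> e w w0; rewrite e -st => ew; apply: (addIr t); rewrite e.
  have [->//|wt0] := eqVneq (w + t) 0.
  by case/eqP: (tE _ w0); apply/esym/D2.
apply/kdoorP; split=> [u|u w] u0 => [|w0]; rewrite !ffunE.
  by have [->//|ut0] := eqVneq (u + t) 0; apply: D1.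
have [/Dt e|ut0] := eqVneq (u + t) 0; first exact: e.
have [/Dt e|wt0] := eqVneq (w + t) 0; first by move=> ?; apply/esym/e.
by move=> /(D2 _ _ ut0 wt0); apply: addIr.
Qed.

(* Flipping pairs up all doors; rotating to the other vertex that shares the
   label of the marked one pairs up the doors that are not panchromatic. *)
Theorem even_panchromatic : ~~ odd #|panchromatic|.
Proof.
pose D := [set s in ksimplex | kdoor s].
have inD s : (s \in D) = (s \in ksimplex) && kdoor s by rewrite finset.in_set.
have Deven : ~~ odd #|D|.
  apply: (@involution_even _ D kflip) => s; rewrite inD => /andP[sS sD].
  split; last exact: kflip_neq; last exact: kflipK.
  by rewrite inD kflip_simplex ?kdoor_flip.
have : ~~ odd #|D :\: panchromatic|.
  apply: (@involution_even _ _ (fun s => krot (twin s) s)) => s.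
  rewrite finset.in_setD in_panchromatic inD => /andP[+ /andP[sS sD]].
  rewrite sS sD /= => s0.
  have [t0 st] := twinP sD s0; set t := twin s in t0 st *.
  have rD := kdoor_rot sD t0 s0 st.
  have r0 : lab ((krot t s).1 0) != ord_max by rewrite ffunE add0r st.
  split.
  - by rewrite finset.in_setD in_panchromatic inD krot_simplex // rD r0.
  - have [t'0] := twinP rD r0; rewrite !ffunE add0r.
    have /kdoorP[_ D2] := sD.
    (* The old marked vertex now sits at position [-t]. It is the only possible twin, because labels
       at nonzero positions of a door are distinct. *)
    have [/eqP|t't e] := eqVneq (twin (krot t s) + t) 0.
      by rewrite addr_eq0 => /eqP -> _; apply: krotK.
    by case/eqP: t'0; apply: (addIr t); rewrite add0r; apply: D2.
  - apply: contra t0 => /eqP /(congr1 (fun x : flag => x.2 (0 : pos))).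
    by rewrite permM permE add0r => /perm_inj ->.
have sub : panchromatic \subset D.
  by apply/fintype.subsetP => s; rewrite in_panchromatic inD => /and3P[-> ->].
have := cardsID panchromatic D; rewrite (finset.setIidPr sub) => cD /negPf odd0.
by move: Deven; rewrite -cD oddD odd0 addbF.
Qed.


Lemma panchromatic_inj s : s \in panchromatic -> injective (fun t => lab (s.1 t)).
Proof.
rewrite in_panchromatic => /and3P[_ /kdoorP[D1 D2] /eqP s0] t u e.
have [t0|t0] := eqVneq t 0; have [u0|u0] := eqVneq u 0.
- by rewrite t0.
- by have := D1 u u0; rewrite -e t0 s0 eqxx.
- by have := D1 t t0; rewrite e u0 s0 eqxx.
- exact: D2.
Qed.
End Sperner.

(** * Sperner labels as first indices *)

Section FirstIndex.
Variables (n : nat) (P : pred 'I_n).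

(** If nothing satisfies [P], the value is [n], the label [ord_max]. *)
Definition first_index : 'I_n.+1 := inord (find P (enum 'I_n)).

Let first_indexE : first_index = find P (enum 'I_n) :> nat.
Proof. by rewrite inordK // ltnS (leq_trans (find_size _ _)) // size_enum_ord. Qed.

Lemma first_indexP (c : 'I_n) : first_index = c :> nat -> P c.
Proof.
rewrite first_indexE => e.
have : has P (enum 'I_n) by rewrite has_find e size_enum_ord.
by move/(nth_find c); rewrite e nth_ord_enum.
Qed.

Lemma before_first_index (c : 'I_n) : (c < first_index)%N -> ~~ P c.
Proof. by rewrite first_indexE => /(before_find c); rewrite nth_ord_enum => ->. Qed.

Lemma first_index_le (c : 'I_n) : P c -> (first_index <= c)%N.
Proof. by move=> Pc; rewrite leqNgt; apply: contraL Pc; apply: before_first_index. Qed.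
End FirstIndex.

Lemma ord_addZp1 N (a : 'I_N.+1) : (a < N)%N -> nat_of_ord (a + Zp1 : 'I_N.+1) = a.+1.
Proof. by case: N a => [|N] a aN //=; rewrite modn_small // addn1. Qed.

Lemma ord_subZp1 N (a : 'I_N.+1) : (0 < a)%N -> (nat_of_ord (a - Zp1 : 'I_N.+1)).+1 = a.
Proof.
move=> a0; have aN := ltn_ord a.
have ea : (inord a.-1 : 'I_N.+1) = a.-1 :> nat by rewrite inordK; lia.
have e : a - Zp1 = inord a.-1 :> 'I_N.+1.
  apply/eqP; rewrite subr_eq; apply/eqP/ord_inj.
  by rewrite ord_addZp1 ea; lia.
by rewrite e /= ea; lia.
Qed.

(** * Simplices with a vertex off the seam, unwrapped into the cube *)

Section Unwrapped.
Variables (m N h : nat).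
Hypothesis h_bounds : (0 < h < N)%N.
Let n := m.+1.
Let torus := {ffun 'I_n -> 'I_N.+1}.
Let pos := 'I_n.+1.
Local Notation flag := ({ffun pos -> torus} * 'S_n.+1)%type.

(** The values 0 and [N] are cyclically adjacent: here opposite faces of the cube meet in the
    torus. *)
Definition seam (x : torus) := [exists c, (x c == ord0) || (x c == ord_max)].

(* The labelling induced by the identity vector field centred at (h, ..., h). *)
Definition half_label (x : torus) : 'I_n.+1 := first_index (fun c => x c < h)%N.

Lemma seamN x : ~~ seam x -> forall c, (0 < x c < N)%N.
Proof.
move=> /existsPn H c; have := H c; rewrite negb_or -!val_eqE /=.
by have := ltn_ord (x c); lia.
Qed.

(** In one turn coordinate [c] goes up once, at the step [lift ord0 c], and down once, at the step
    [ord0]. Starting strictly between 0 and [N] it never wraps around. *)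
Lemma unwrapped_path (s : flag) t0 : s \in ksimplex m N -> ~~ seam (s.1 t0) ->
  forall (c : 'I_n) i, (i <= n.+1)%N ->
  s.1 (t0 + i%:R) c = (s.1 t0 c + (((s.2^-1)%g (lift ord0 c) - t0)%R < i)
                      - (((s.2^-1)%g ord0 - t0)%R < i))%N :> nat.
Proof.
move=> /ksimplexP; set v := s.1; set sg := s.2 => vP /seamN vt0 c; have := vt0 c.
set w := v t0 c => w0.
have posE (a : pos) (i : nat) : (i <= n)%N ->
    (sg (t0 + i%:R) == a) = ((sg^-1)%g a - t0 == i :> nat).
  move=> iN; rewrite -(inj_eq (@perm_inj _ (sg^-1)%g)) permK [_ == _ :> nat]eq_sym.
  rewrite addrC -[LHS](inj_eq (addIr (- t0))) addrK -val_eqE /= Zp_nat /=.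
  by rewrite modn_small.
have pq : ((sg^-1)%g (lift ord0 c) - t0 : pos) != ((sg^-1)%g ord0 - t0 : pos) :> nat.
  by rewrite val_eqE (inj_eq (addIr _)) (inj_eq perm_inj) eq_sym neq_lift.
move: (posE (lift ord0 c)) (posE ord0) pq.
move: (nat_of_ord ((sg^-1)%g (lift ord0 c) - t0)) => p.
move: (nat_of_ord ((sg^-1)%g ord0 - t0)) => q {posE} pE qE pq.
elim=> [|i IHi] iN; first by rewrite addr0 !ltn0 addn0 subn0.
rewrite -natr1 addrA vP ffunE; move/(_ (ltnW iN)): IHi.
set a := v _ c => IHi.
rewrite /kstep ffunE pE // qE //.
case: (p =P i) => [pi|/eqP pi].
  by rewrite ord_addZp1; lia.
case: (q =P i) => [qi|/eqP qi].
  by have := @ord_subZp1 N a; lia.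
by rewrite addr0 IHi; lia.
Qed.

Lemma unwrapped_step (s : flag) t0 : s \in ksimplex m N -> ~~ seam (s.1 t0) ->
  forall (t : pos) (c : 'I_n),
  (s.1 (t + 1)%R c + (s.2 t == ord0) = s.1 t c + (s.2 t == lift ord0 c))%N.
Proof.
move=> sS st0 t c; have [w0 wN] := andP (seamN st0 c).
have tE : t = t0 + (nat_of_ord (t - t0))%:R by rewrite Zp_nat valZpK addrC subrK.
have H := unwrapped_path sS st0 c.
have tn := ltn_ord (t - t0).
have := H (t - t0 : pos)%R (ltnW tn); rewrite -tE => ->.
have := H (t - t0 : pos)%R.+1 tn; rewrite -natr1 addrA -tE => ->.
have eqE (a : pos) : (s.2 t == a) = (((s.2^-1)%g a - t0 : pos) == (t - t0 : pos) :> nat).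
  by rewrite val_eqE (inj_eq (addIr _)); apply/eqP/eqP => <-; rewrite ?permK ?permKV.
rewrite !eqE.
have : ((s.2^-1)%g (lift ord0 c) - t0 : pos) != ((s.2^-1)%g ord0 - t0 : pos) :> nat.
  by rewrite val_eqE (inj_eq (addIr _)) (inj_eq perm_inj) eq_sym neq_lift.
move: (nat_of_ord ((s.2^-1)%g (lift ord0 c) - t0)) => p.
move: (nat_of_ord ((s.2^-1)%g ord0 - t0)) => q.
move: (nat_of_ord (t - t0)) => i; lia.
Qed.

Lemma unwrapped_near (s : flag) t0 : s \in ksimplex m N -> ~~ seam (s.1 t0) ->
  forall (t : pos) (c : 'I_n), (s.1 t c <= (s.1 t0 c).+1)%N && (s.1 t0 c <= (s.1 t c).+1)%N.
Proof.
move=> sS st0 t c.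
have tE : t = t0 + (nat_of_ord (t - t0))%:R by rewrite Zp_nat valZpK addrC subrK.
have := unwrapped_path sS st0 c (ltnW (ltn_ord (t - t0))); rewrite -tE => ->; lia.
Qed.

(** A step other than [ord0] only raises a coordinate, so the label cannot drop and, labels being
    distinct, must grow. The single descent [ord0] therefore starts at the top label, and this
    monotonicity determines labels, steps and coordinates. *)
Lemma half_label_panchromatic (s : flag) t0 : ~~ seam (s.1 t0) ->
  s \in panchromatic half_label ->
  s = ([ffun t : pos => [ffun c : 'I_n =>
          inord (h.-1 + ((t == ord0) || (c.+1 < t)%N))]], 1%g).
Proof.
move=> st0 sP; have inj := panchromatic_inj sP.
move: sP; rewrite in_panchromatic => /and3P[sS _ /eqP s0].
have step := unwrapped_step sS st0.
case: s => v sg in st0 sS s0 inj step *; rewrite /= in st0 s0 inj step.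
have mono t : sg t != ord0 -> (half_label (v t) < half_label (v (t + 1)%R))%N.
  move=> sgt; rewrite ltn_neqAle val_eqE (inj_eq inj); apply/andP; split.
    by rewrite -[X in X != _]addr0 (inj_eq (addrI t)) eq_sym oner_eq0.
  rewrite leqNgt; apply/negP => lt.
  have ltn : (half_label (v (t + 1)%R) < n)%N.
    by apply: leq_trans lt _; rewrite -ltnS.
  have /first_indexP /= vt1 : half_label (v (t + 1)) = Ordinal ltn :> nat by [].
  have /before_first_index /= : (Ordinal ltn < half_label (v t))%N by [].
  by have := step t (Ordinal ltn); rewrite (negPf sgt); lia.
have sg0 : sg 0 = ord0.
  by apply/eqP/negPn/negP => /mono; rewrite s0 ltnNge leq_ord.
have natE i : (i <= n)%N -> nat_of_ord (i%:R : pos) = i.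
  by move=> iN; rewrite Zp_nat /= modn_small.
have liftE (c : 'I_n) : lift ord0 c = c.+1%:R by apply: ord_inj; rewrite natE.
have sgS i : (0 < i <= n)%N -> sg i%:R != ord0.
  by move=> i0; rewrite -sg0 (inj_eq perm_inj) -val_eqE /= natE; lia.
(* Strict growth from position 1 upwards and from position [n] downwards squeezes the label at
   position [c + 1] to [c]. *)
have low i : (0 < i <= n)%N -> (i.-1 <= half_label (v i%:R))%N.
  elim: i => // -[_ //|i IHi] iN; rewrite -natr1.
 exact: leq_ltn_trans (IHi ltac:(lia)) (mono _ (sgS i.+1 ltac:(lia))).
have up i : (i < n)%N -> (half_label (v (n - i)%:R) <= n.-1 - i)%N.
  elim: i => [|i IHi] iN.
    have := mono _ (sgS n ltac:(lia)); rewrite subn0 natr1.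
    have -> : n.+1%:R = 0 :> pos by apply: ord_inj; rewrite Zp_nat /= modnn.
    by rewrite s0 ltnS subn0.
  have := mono _ (sgS (n - i.+1)%N ltac:(lia)); have e : ((n - i.+1).+1 = n - i)%N by lia.
  rewrite natr1 e.
  by move/leq_trans/(_ (IHi ltac:(lia))); lia.
have labE (c : 'I_n) : half_label (v (lift ord0 c)) = c :> nat.
  have cn := ltn_ord c; apply/eqP; rewrite eqn_leq liftE (low c.+1) // andbT.
  by have := up (n - c.+1)%N ltac:(lia); rewrite subKn // => /leq_trans; apply; lia.
(* Label [c] at position [c + 1] puts coordinate [c] below [h], and the larger next label puts it at
   [h] or above, so this step raises coordinate [c]. The same crossing gives [v0h]. *)
have sgE : sg = 1%g.
  apply/permP => t; rewrite perm1; case: (unliftP ord0 t) => [c ->|->//].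
  have /first_indexP/= := labE c.
  have /= lc := mono (lift ord0 c).
  have sgc : sg (lift ord0 c) != ord0 by rewrite -[X in _ != X]sg0
    (inj_eq perm_inj) eq_sym; apply: neq_lift.
  have := lc sgc; rewrite labE => /before_first_index.
  by have := step (lift ord0 c) c; rewrite (negPf sgc); case: eqP => //; lia.
congr pair => //; apply/ffunP => t; apply/ffunP => c; rewrite !ffunE.
have vc i : (i <= n)%N -> (v i%:R c + 1 = v 0%R c + ((i == 0) || (c.+1 < i)))%N.
  elim: i => [|i IHi] iN //; have := step i%:R c.
  rewrite natr1 sgE perm1 -!val_eqE /= !natE; try lia.
  have ar (a b w k : nat) : (a + 1 = w + ((i == 0) || (k.+1 < i)) ->
    b + (i == 0) = a + (i == k.+1) -> b + 1 = w + (k.+1 < i.+1))%N by lia.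
  exact: ar (IHi (ltnW iN)).
have v0h : v 0 c = h :> nat.
  have cn := ltn_ord c; have /first_indexP/= lt_h := labE c.
  have := mono (lift ord0 c); rewrite labE sgE perm1 => /(_ isT)/before_first_index.
  have := step (lift ord0 c) c; rewrite sgE perm1 eqxx addn0 => ->.
  have := vc c.+1 cn; rewrite -liftE ltnn addn0 => <-; rewrite -leqNgt => ge_h.
  by apply/eqP; rewrite eqn_leq ge_h addn1 lt_h.
apply: ord_inj; rewrite inordK; last by have := h_bounds; lia.
have := vc t; rewrite Zp_nat valZpK v0h -!val_eqE /= -ltnS => /(_ (ltn_ord t)).
move=> e; apply/eqP; rewrite -(eqn_add2r 1) e addnAC addn1 prednK //.
by case/andP: h_bounds.
Qed.

Lemma half_label_panchromatic_ex :
  exists2 s : flag, ~~ seam (s.1 0) & s \in panchromatic half_label.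
Proof.
(* From [(h, ..., h)] the walk drops to [(h - 1, ..., h - 1)], then raises the coordinates one by
   one in order. *)
pose x0 (t : pos) (c : 'I_n) : 'I_N.+1 := inord (h.-1 + ((t == ord0) || (c.+1 < t)%N)).
have x0E t c : x0 t c = (h.-1 + ((t == ord0) || (c.+1 < t)%N))%N :> nat.
  by rewrite inordK //; have := h_bounds; lia.
pose v := [ffun t : pos => [ffun c : 'I_n => x0 t c]].
exists (v, 1%g).
  apply/existsPn => c; rewrite !ffunE negb_or -!val_eqE /= x0E eqxx.
  by have := h_bounds; lia.
have v0 : half_label (v 0) = n :> nat.
  apply/eqP; rewrite eqn_leq leq_ord /= leqNgt; apply/negP => lt.
  have /first_indexP /= : half_label (v 0) = Ordinal lt :> nat by [].
  move: (Ordinal lt) => c; rewrite !ffunE x0E eqxx; have := h_bounds; lia.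
have vt (c : 'I_n) : half_label (v (lift ord0 c)) = c :> nat.
  apply/eqP; rewrite eqn_leq; apply/andP; split.
    by apply: first_index_le; rewrite !ffunE x0E /= /bump; have := h_bounds; lia.
  rewrite leqNgt; apply/negP => lt.
  have ltn := ltn_trans lt (ltn_ord c).
  have /first_indexP /= : half_label (v (lift ord0 c)) = Ordinal ltn :> nat by [].
  have : (Ordinal ltn < c)%N by [].
  move: (Ordinal ltn) => b; rewrite !ffunE x0E /= /bump; have := h_bounds; lia.
rewrite in_panchromatic -val_eqE /= v0 eqxx andbT; apply/andP; split.
  apply/ksimplexP => t /=; rewrite perm1; apply/ffunP => c; rewrite !ffunE.
  apply: ord_inj; have cn := ltn_ord c.
  case: (unliftP ord0 t) => [b ->|->].
    have bn := ltn_ord b.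
    have -> : x0 (lift ord0 b + 1) c = (h.-1 + (c <= b)%N)%N :> nat.
      rewrite x0E -!val_eqE /= /bump leq0n [(1 %% _)%N]modn_small //.
      rewrite -[nat_of_bool true]/1%N add1n addn1.
      have [bm|mb] := ltnP b m; first by rewrite modn_small.
      have -> : (b.+2 = n.+1)%N by do 2 congr _.+1; apply/eqP; rewrite eqn_leq mb -ltnS bn.
      by rewrite modnn (leq_trans _ mb).
    have lb0 : (lift ord0 b == ord0) = false by rewrite eq_sym; apply/negbTE/neq_lift.
    rewrite (inj_eq lift_inj) lb0.
    have x0l : x0 (lift ord0 b) c = (h.-1 + (c < b)%N)%N :> nat by rewrite x0E lb0.
    have [bc|bc] := eqVneq b c; last by rewrite addr0 x0l leq_eqVlt val_eqE eq_sym (negPf bc).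
    have x0h : x0 (lift ord0 b) c = h.-1 :> nat by rewrite x0l bc ltnn addn0.
    by rewrite ord_addZp1 x0h ?bc ?leqnn ?addn1 //; have := h_bounds; lia.
  rewrite (negPf (neq_lift _ _)) eqxx; apply: succn_inj.
  rewrite ord_subZp1 !x0E ?addn1 //= addn0 prednK //.
  by case/andP: h_bounds.
apply/kdoorP; split=> [t|t u] t0 /=.
  case: (unliftP ord0 t) t0 => [b -> _|-> //].
  by rewrite -val_eqE /= vt ltn_eqF.
case: (unliftP ord0 t) t0 => [b -> _|-> //].
case: (unliftP ord0 u) => [c -> _|-> //].
by move=> /(congr1 (@nat_of_ord _)); rewrite !vt => /ord_inj ->.
Qed.

(** Simplices lying wholly on the seam count equally for [lab] and [half_label]. Both totals are
    even and [half_label] has exactly one other simplex, so [lab] cannot have none. *)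
Theorem panchromatic_off_seam (lab : torus -> 'I_n.+1) :
  (forall x, seam x -> lab x = half_label x) ->
  exists2 s : flag, s \in panchromatic lab & exists t, ~~ seam (s.1 t).
Proof.
move=> labE; pose A := [set s : flag | [exists t, ~~ seam (s.1 t)]].
have inA s : (s \in A) = [exists t, ~~ seam (s.1 t)] by rewrite finset.in_set.
have [PA0|[s]] := finset.set_0Vmem (panchromatic lab :&: A); last first.
  by rewrite finset.in_setI inA => /andP[sP /existsP ex]; exists s.
have /esym := cardsID A (panchromatic lab); rewrite PA0 cards0 add0n => cE.
have PE : panchromatic lab :\: A = panchromatic half_label :\: A.
  apply/finset.setP => s; rewrite !finset.in_setD inA; case: existsP => //= sseam.
  have labs t : lab (s.1 t) = half_label (s.1 t).
    by case: (boolP (seam (s.1 t))) => [/labE//|ns]; case: sseam; exists t.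
  rewrite !in_panchromatic labs; congr [&& _, _ & _].
  apply/kdoorP/kdoorP => -[D1 D2]; split=> [t /D1|t u t0 u0].
  - by rewrite labs.
  - by rewrite -!labs; apply: D2.
  - by rewrite labs.
  - by rewrite !labs; apply: D2.
have [s0 s0N s0P] := half_label_panchromatic_ex.
have P1 : panchromatic half_label :&: A = [set s0].
  apply/finset.setP => s; rewrite finset.in_set1 finset.in_setI inA.
  apply/andP/eqP => [[sP /existsP[t tN]]|->].
    by rewrite (half_label_panchromatic tN sP) -(half_label_panchromatic s0N s0P).
  by split=> //; apply/existsP; exists 0.
have := even_panchromatic half_label; rewrite -(cardsID A) P1 cards1 oddD -PE -cE.
by rewrite (negPf (even_panchromatic lab)).
Qed.

Corollary panchromatic_cluster (lab : torus -> 'I_n.+1) :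
  (forall x, seam x -> lab x = half_label x) ->
  exists x0 : torus, forall a, exists2 x, lab x = a &
    forall c, (x c <= (x0 c).+1)%N && (x0 c <= (x c).+1)%N.
Proof.
move=> /panchromatic_off_seam[s sP [t0 st0]]; exists (s.1 t0) => a.
have [g _ gK] := injF_bij (panchromatic_inj sP).
exists (s.1 (g a)); first exact: gK.
by apply: unwrapped_near => //; move: sP; rewrite in_panchromatic => /and3P[].
Qed.
End Unwrapped.

Local Open Scope classical_set_scope.

Lemma rV_norm_leP (R : realType) n (x : 'rV[R]_n) (e : R) : 0 <= e ->
  (forall c, `|x 0 c| <= e) <-> `|x| <= e.
Proof.
move=> e0; rewrite -[`|x|]/(mx_norm x) mx_normrE; split=> [H|/bigmax_leP[_ H] c].
  by apply/bigmax_leP; split=> // -[i c] _ /=; rewrite (ord1 i).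
exact: (H (0, c)).
Qed.

(** * The no-retraction theorem *)

Section Grid.
Variables (R : realType) (m h : nat) (r : R).
Hypotheses (h0 : (0 < h)%N) (r0 : 0 < r).
Let n := m.+1.
Let torus := {ffun 'I_n -> 'I_(h.*2).+1}.

(** The index [h] goes to the origin and the seam to the boundary; the norm is the sup norm, so
    balls are cubes. *)
Definition grid_point (x : torus) : 'rV[R]_n :=
  \row_c (r / h%:R * ((x c)%:R - h%:R)).

Lemma grid_point_norm x : `|grid_point x| <= r.
Proof.
have hR : 0 < h%:R :> R by rewrite ltr0n.
have rh := divr_gt0 r0 hR.
apply/rV_norm_leP => [|c]; first exact: ltW.
rewrite mxE normrM (ger0_norm (ltW rh)) mulrAC ler_pdivrMr // ler_pM2l //.
have e : (h.*2)%:R = h%:R + h%:R :> R by rewrite -addnn natrD.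
have xc : (x c)%:R <= h%:R + h%:R :> R by rewrite -e ler_nat -ltnS.
by have := ler0n R (x c); rewrite ler_norml; lra.
Qed.

Lemma grid_point_seam x : seam x -> `|grid_point x| = r.
Proof.
have hR : 0 < h%:R :> R by rewrite ltr0n.
have rh := divr_gt0 r0 hR.
case/existsP => c Hc; apply/eqP; rewrite eq_le grid_point_norm /=.
have <- : `|grid_point x 0 c| = r.
  rewrite mxE normrM (ger0_norm (ltW rh)) mulrAC.
  have -> : `|(x c)%:R - h%:R| = h%:R :> R.
    case/orP: Hc => /eqP -> /=; first by rewrite sub0r normrN ger0_norm.
    by rewrite -addnn natrD addrK ger0_norm.
  by rewrite mulfK ?gt_eqF.
exact: (rV_norm_leP _ (normr_ge0 _)).2.
Qed.

Lemma grid_point_lt0 (x : torus) c : (grid_point x 0 c < 0) = (x c < h)%N.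
Proof.
by rewrite mxE pmulr_rlt0 ?divr_gt0 ?ltr0n // subr_lt0 ltr_nat.
Qed.

Lemma grid_point_near (x y : torus) :
  (forall c, (x c <= (y c).+1)%N && (y c <= (x c).+1)%N) ->
  `|grid_point x - grid_point y| <= r / h%:R.
Proof.
have rh : 0 < r / h%:R by rewrite divr_gt0 ?ltr0n.
move=> xy; apply/rV_norm_leP => [|c]; first exact: ltW.
have /andP[] := xy c; rewrite -(ler_nat R) -[(y c <= _)%N](ler_nat R) -!natr1.
rewrite !mxE -mulrBr opprB addrA subrK normrM (ger0_norm (ltW rh)) => xy1 yx1.
by apply: ler_piMr; [exact: ltW|rewrite ler_norml; lra].
Qed.
End Grid.

Lemma rV_ball_compact (R : realType) n (r : R) : compact [set y : 'rV[R]_n | `|y| <= r].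
Proof.
apply: bounded_closed_compact.
  by exists r; split; rewrite ?num_real // => M rM y /= /le_trans; apply; apply: ltW.
apply: (@preimage_closed _ _ (fun y : 'rV[R]_n => `|y| : R) [set t : R | t <= r]).
  by move=> y _; apply: norm_continuous.
exact: closed_le.
Qed.

(** Without a zero, compactness yields a mesh at which some coordinate [c] of [G] has constant sign
    around each grid point. A cluster with all labels refutes this: label [c] excludes a positive
    sign, [ord_max] a negative one. *)
Theorem cube_zero (R : realType) n (r : R) (G : 'rV[R]_n -> 'rV[R]_n) :
  0 < r ->
  (forall y, `|y| <= r -> {for y, continuous G}) ->
  (forall y, `|y| = r -> G y = y) ->
  exists2 y, `|y| <= r & G y = 0.
Proof.
move=> r0; case: n G => [|m] G Gc Gb.
  by exists 0; rewrite ?normr0 ?ltW // thinmx0.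
apply: contrapT => no0.
pose P (h : nat) (x : 'rV[R]_m.+1) := exists c,
  (forall z, `|x - z| <= r / h.+1%:R -> 0 < G z 0 c) \/
  (forall z, `|x - z| <= r / h.+1%:R -> G z 0 c < 0).
have cover : \forall h \near \oo, [set y : 'rV[R]_m.+1 | `|y| <= r] `<=` P h.
  have nc := (compact_near_coveringP _).1 (@rV_ball_compact R m.+1 r).
  apply: (nc nat \oo P eventually_filter) => y /= yr.
  have [c Gyc] : exists c, G y 0 c != 0.
    apply: contrapT => H; apply: no0; exists y => //; apply/rowP => c; rewrite mxE.
    by apply/eqP/negPn/negP => ?; apply: H; exists c.
  have Gcc : {for y, continuous (fun z => G z 0 c)}.
    by apply: (@continuous_comp _ _ _ G (fun M : 'rV[R]_m.+1 => M 0 c));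
      [apply: Gc | apply: coord_continuous].
  have key (Q : R -> Prop) : (\forall z \near y, Q (G z 0 c)) ->
    \forall x \near y & h \near \oo, forall z, `|x - z| <= r / h.+1%:R -> Q (G z 0 c).
    move=> /nbhs_ballP[e /= e0 He]; have e2 : 0 < r^-1 * (e / 2).
      by rewrite mulr_gt0 ?invr_gt0 // divr_gt0.
    exists (ball y (e / 2), [set h | h.+1%:R^-1 < r^-1 * (e / 2)]) => /=.
      by split; [apply: nbhsx_ballx; rewrite divr_gt0 | exact: near_infty_natSinv_lt (PosNum e2)].
    move=> [x h] [/= yx]; rewrite ltr_pdivlMl // => rh z xz; apply: He.
    move: yx; rewrite -!ball_normE /= => yx; rewrite [e]splitr.
    have -> : y - z = (y - x) + (x - z) by rewrite addrA subrK.
    by apply: le_lt_trans (ler_normD _ _) _; rewrite ltrD // (le_lt_trans xz).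
  have [Gpos|Gneg|Gz] := ltrgt0P (G y 0 c); last by rewrite Gz eqxx in Gyc.
    apply: (filterS _ (key (fun t => 0 < t) (cvgr_gt _ Gcc _ Gpos))) => -[x h] /= H.
  by exists c; left.
  apply: (filterS _ (key (fun t => t < 0) (cvgr_lt _ Gcc _ Gneg))) => -[x h] /= H.
  by exists c; right.
have [h hP] : exists h, [set y : 'rV[R]_m.+1 | `|y| <= r] `<=` P h.
  by have [h _ H] := cover; exists h; apply: H => /=.
pose lab x : 'I_m.+2 := first_index (fun c => G (@grid_point R m h.+1 r x) 0 c < 0).
have hb : (0 < h.+1 < h.+1.*2)%N by rewrite -addnn; lia.
have labE x : seam x -> lab x = half_label h.+1 x.
  move=> sx; congr first_index; apply/funext => c.
  by rewrite Gb ?grid_point_seam // grid_point_lt0.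
have [x0 near0] := panchromatic_cluster hb labE.
have [c [Gpos|Gneg]] := hP _ (grid_point_norm (ltn0Sn h) r0 x0).
- have [x labx xx0] := near0 (widen_ord (leqnSn _) c).
  have : G (grid_point r x) 0 c < 0.
    by apply: (first_indexP (P := fun c => G (grid_point r x) 0 c < 0)); rewrite -/(lab x) labx.
  rewrite ltNge => /negP; apply; apply/ltW/Gpos.
  by apply: grid_point_near => // d; rewrite andbC.
- have [x labx xx0] := near0 ord_max.
  have := @before_first_index _ (fun c => G (grid_point r x) 0 c < 0) c.
  rewrite -/(lab x) labx => /(_ (ltn_ord c)) /negP; apply; apply: Gneg.
  by apply: grid_point_near => // d; rewrite andbC.
Qed.

(** * Continuity of matrix-valued maps and perturbation on compact sets *)

Section MatrixContinuity.
Variables (R : realType) (T : topologicalType).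

Lemma continuous_mx m n (F : T -> 'M[R]_(m, n)) (x : T) :
  (forall i j, {for x, continuous (fun y => F y i j)}) -> {for x, continuous F}.
Proof.
move=> cF; apply/cvg_ballP => e e0.
have H : \forall y \near x, forall ij : 'I_m * 'I_n, ball (F x ij.1 ij.2) e (F y ij.1 ij.2).
  apply: filter_forall => -[i j] /=.
  exact: (cvg_ballP _ _).1 (cF i j) e e0.
by apply: filterS H => y H; split=> // i j; apply: (H (i, j)).
Qed.

Lemma continuous_entry m n (F : T -> 'M[R]_(m, n)) (x : T) i j :
  {for x, continuous F} -> {for x, continuous (fun y => F y i j)}.
Proof.
move=> cF; apply: (@continuous_comp _ _ _ F (fun M : 'M[R]_(m, n) => M i j)) => //.
exact: coord_continuous.
Qed.

Lemma continuous_mulmx m n p (F : T -> 'M[R]_(m, n)) (H : T -> 'M[R]_(n, p)) (x : T) :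
  {for x, continuous F} -> {for x, continuous H} ->
  {for x, continuous (fun y => F y *m H y)}.
Proof.
move=> cF cH; apply: continuous_mx => i j.
rewrite /prop_for /continuous_at mxE.
under eq_fun do rewrite mxE.
apply: cvg_big => [|k _]; first exact: add_continuous.
by apply: cvgM; apply: continuous_entry.
Qed.

Lemma continuous_colsub m n p (f : 'I_p -> 'I_n) (F : T -> 'M[R]_(m, n)) (x : T) :
  {for x, continuous F} -> {for x, continuous (fun y => colsub f (F y))}.
Proof.
move=> cF; apply: continuous_mx => i j.
under [X in {for _, continuous X}]eq_fun do rewrite mxE.
exact: continuous_entry.
Qed.

Lemma continuous_addmx m n (F H : T -> 'M[R]_(m, n)) (x : T) :
  {for x, continuous F} -> {for x, continuous H} ->
  {for x, continuous (fun y => F y + H y)}.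
Proof. by move=> cF cH; apply: cvgD. Qed.

Lemma continuous_submx m n (F H : T -> 'M[R]_(m, n)) (x : T) :
  {for x, continuous F} -> {for x, continuous H} ->
  {for x, continuous (fun y => F y - H y)}.
Proof. by move=> cF cH; apply: cvgB. Qed.

Lemma continuous_scalemx m n (a : T -> R) (F : T -> 'M[R]_(m, n)) (x : T) :
  {for x, continuous a} -> {for x, continuous F} ->
  {for x, continuous (fun y => a y *: F y)}.
Proof. by move=> ca cF; apply: cvgZ. Qed.

Lemma continuous_const_at (U : topologicalType) (c : U) (x : T) :
  {for x, continuous (fun=> c)}.
Proof. exact: cvg_cst. Qed.

Lemma continuous_cutoff (a : T -> R) (c : R) (x : T) : {for x, continuous a} ->
  {for x, continuous (fun y => ((c * a y - 1) + `|c * a y - 1|) / 2)}.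
Proof.
move=> ca; apply: cvgM; last exact: cvg_cst.
have c1 : {for x, continuous (fun y => c * a y - 1)}.
  by apply: cvgB; [apply: cvgM; [exact: cvg_cst|exact: ca]|exact: cvg_cst].
by apply: cvgD => //; exact: cvg_norm.
Qed.

Lemma continuous_onem (a : T -> R) (x : T) : {for x, continuous a} ->
  {for x, continuous (fun y => 1 - a y)}.
Proof. by move=> ca; apply: cvgB => //; exact: cvg_cst. Qed.
End MatrixContinuity.

(** Locally [F0] is bounded away from 0 and [F1] is bounded, so a small multiple of [F1] cannot
    cancel [F0]; compactness makes the multiple uniform. *)
Lemma compact_perturb_neq0 (R : realType) (T : topologicalType) (V : normedModType R)
    (K : set T) (F0 F1 : T -> V) : compact K ->
  (forall y, K y -> {for y, continuous F0} /\ {for y, continuous F1}) ->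
  (forall y, K y -> F0 y != 0) ->
  exists2 e : R, 0 < e & forall y, K y -> F0 y + e *: F1 y != 0.
Proof.
move=> cK cF nz.
pose P (h : nat) y := F0 y + h.+1%:R^-1 *: F1 y != 0.
have : \forall h \near \oo, K `<=` P h.
  apply: ((compact_near_coveringP _).1 cK nat \oo P eventually_filter) => y Ky.
  have [cF0 cF1] := cF y Ky.
  have a0 : 0 < `|F0 y| / 2 by rewrite divr_gt0 ?normr_gt0 ?nz.
  have b0 : 0 < `|F1 y| + 1 by rewrite ltr_wpDl.
  have ab := divr_gt0 a0 b0.
  have N0 : \forall z \near y, `|F0 y| / 2 < `|F0 z|.
    by apply: (cvgr_gt (`|F0 y|)); [exact: cvg_norm | lra].
  have N1 : \forall z \near y, `|F1 z| < `|F1 y| + 1.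
    by apply: (cvgr_lt (`|F1 y|)); [exact: cvg_norm | lra].
  exists ([set z | `|F0 y| / 2 < `|F0 z| /\ `|F1 z| < `|F1 y| + 1],
      [set h : nat | h.+1%:R^-1 < `|F0 y| / 2 / (`|F1 y| + 1)]).
    by split=> /=; [apply: filterS2 N0 N1 => z | exact: near_infty_natSinv_lt (PosNum ab)].
  move=> [z h] [/= [z0 z1] hh]; rewrite /P addr_eq0; apply/eqP => e.
  move: z0; rewrite e normrN normrZ ger0_norm ?invr_ge0 // => z0.
  move: hh; rewrite ltr_pdivlMr // => hh.
  have : h.+1%:R^-1 * `|F1 z| <= h.+1%:R^-1 * (`|F1 y| + 1).
    by rewrite ler_pM2l ?invr_gt0 // ltW.
  by move=> /(lt_le_trans z0)/(lt_trans)/(_ hh); rewrite ltxx.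
case=> h _ H; exists h.+1%:R^-1; first by rewrite invr_gt0.
by apply: H => /=.
Qed.

(** * Fibers near a given one *)

Section Core.
Variables (R : realType) (n k : nat) (r : R) (f : 'I_k -> 'I_n).
Variables (A : 'rV[R]_n -> 'M[R]_(k, n)) (v d : 'rV[R]_n).
Hypothesis r0 : 0 < r.
Hypothesis cA : forall y, `|y| <= r -> {for y, continuous A}.
Hypothesis Af : forall y, `|y| <= r -> colsub f (A y) = 1%:M.

Let Phi y (w : 'rV[R]_n) := w - colsub f w *m A y.

Let cPhi (w : 'rV[R]_n -> 'rV[R]_n) y : `|y| <= r -> {for y, continuous w} ->
  {for y, continuous (fun y => Phi y (w y))}.
Proof.
move=> yr cw; have h1 := continuous_colsub (f := f) cw.
exact: (continuous_submx cw (continuous_mulmx h1 (cA yr))).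
Qed.

Let colsub_Phi y w : `|y| <= r -> colsub f (Phi y w) = 0.
Proof. by move=> yr; rewrite /Phi linearB /= -mulmx_colsub Af // mulmx1 subrr. Qed.

Let Phi_linear y a w b w' : Phi y (a *: w + b *: w') = a *: Phi y w + b *: Phi y w'.
Proof.
by rewrite /Phi linearP linearZ /= mulmxDl -!scalemxAl !scalerBr opprD addrACA.
Qed.

(** The positive part of [2 / r * |y| - 1]: a cutoff that is 0 up to radius [r / 2] and 1 at radius
    [r]. *)
Let tau (y : 'rV[R]_n) : R := ((2 / r * `|y| - 1) + `|2 / r * `|y| - 1|) / 2.

Let tau_continuous : continuous tau.
Proof.
by move=> y; apply: continuous_cutoff; exact: norm_continuous.
Qed.

Let tau_small y : `|y| <= r / 2 -> tau y = 0.
Proof.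
move=> yr; rewrite /tau ler0_norm ?subrr ?mul0r //.
by rewrite subr_le0 mulrAC ler_pdivrMr // mul1r; lra.
Qed.

Let tau_boundary y : `|y| = r -> tau y = 1.
Proof.
move=> yr; rewrite /tau yr divfK ?gt_eqF //.
by rewrite (_ : 2 - 1 = 1 :> R) ?normr1; lra.
Qed.

(* F0 + e F1 interpolates between the projected field and the identity on the
   boundary; the summand colsub f y *m A 0 forces its zeros into the slice
   colsub f y = 0. *)
Let F0 (y : 'rV[R]_n) := (1 - tau y) *: (Phi y v + colsub f y *m A 0) + tau y *: y.
Let F1 (y : 'rV[R]_n) := (1 - tau y) *: Phi y (d + y).

Let tauC_continuous y : {for y, continuous (fun y => 1 - tau y)}.
Proof. exact: (continuous_onem (@tau_continuous y)). Qed.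

Let id_continuous (y : 'rV[R]_n) : {for y, continuous (fun y : 'rV[R]_n => y)}.
Proof. exact: cvg_id. Qed.

Let F0_continuous y : `|y| <= r -> {for y, continuous F0}.
Proof.
move=> yr; have h1 := cPhi yr (@continuous_const_at _ _ v y).
have h2 := continuous_mulmx (continuous_colsub (f := f) (@id_continuous y))
  (@continuous_const_at _ _ (A 0) y).
have h3 := continuous_scalemx (@tauC_continuous y) (continuous_addmx h1 h2).
exact: (continuous_addmx h3 (continuous_scalemx (@tau_continuous y) (@id_continuous y))).
Qed.

Let F1_continuous y : `|y| <= r -> {for y, continuous F1}.
Proof.
move=> yr.
have h := cPhi yr (continuous_addmx (@continuous_const_at _ _ d y) (@id_continuous y)).
exact: (continuous_scalemx (@tauC_continuous y) h).
Qed.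

(** The f-coordinates of [Phi] vanish and [A 0] is normalized, so those of the whole field sum to
    [colsub f y]. On the slice [Phi y y = y], which lets all terms be written through [Phi y]. *)
Let F_zero y e : `|y| <= r -> F0 y + e *: F1 y = 0 -> colsub f y = 0 /\
  (1 - tau y) *: Phi y (v + e *: (d + y)) + tau y *: Phi y y = 0.
Proof.
move=> yr F_0.
have fy : colsub f y = 0.
  have cD (x z : 'rV[R]_n) : colsub f (x + z) = colsub f x + colsub f z by rewrite linearD.
  have cZ a (x : 'rV[R]_n) : colsub f (a *: x) = a *: colsub f x by rewrite linearZ.
  have := congr1 (colsub f) F_0; rewrite /F0 /F1.
  move: (Phi y v) (Phi y (d + y)) (colsub_Phi v yr) (colsub_Phi (d + y) yr) => p q p0 q0.
  rewrite !(cD, cZ) -mulmx_colsub p0 q0 [RHS]linear0.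
  by rewrite Af ?normr0 ?ltW // mulmx1 !scaler0 addr0 add0r -scalerDl subrK scale1r.
have e1 : v + e *: (d + y) = 1 *: v + e *: (d + y) by rewrite scale1r.
have Phiy : Phi y y = y by rewrite /Phi fy mul0mx subr0.
split=> //; rewrite -[RHS]F_0 /F0 /F1 fy mul0mx addr0 e1 Phi_linear Phiy scale1r.
by rewrite scalerDr -!addrA [_ + tau y *: y]addrC !scalerA [e * _]mulrC.
Qed.

(** The hypotheses are the three facts about fibers, with [d] in the role of p - q. *)
Lemma no_displacement :
  (forall y, `|y| <= r -> colsub f y = 0 -> Phi y v = 0 -> y = 0) ->
  (forall y s, `|y| <= r -> colsub f y = 0 -> Phi y (y + s *: v) = 0 -> y = 0) ->
  (forall y s, `|y| <= r -> Phi y (v + s *: (d + y)) = 0 -> s = 0) ->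
  False.
Proof.
move=> H1 H2 H3.
(* Only this shell needs the perturbation bound: nearer to 0 the cutoff vanishes and the third
   hypothesis excludes zeros. *)
pose K := [set y : 'rV[R]_n | `|y| <= r] `&` [set y : 'rV[R]_n | r / 2 <= `|y|].
have cK : compact K.
  apply: compact_closedI; first exact: rV_ball_compact.
  apply: (@preimage_closed _ _ (fun y : 'rV[R]_n => `|y| : R) [set t : R | r / 2 <= t]).
    by move=> y _; apply: norm_continuous.
  exact: closed_ge.
have F0K y : K y -> F0 y != 0.
  move=> [/= yr ry]; apply/eqP => F0y.
  have y0 : y != 0 by rewrite -normr_gt0 (lt_le_trans _ ry) // divr_gt0.
  have [fy] : colsub f y = 0 /\
      (1 - tau y) *: Phi y (v + 0 *: (d + y)) + tau y *: Phi y y = 0.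
    by apply: F_zero => //; rewrite scale0r addr0.
  rewrite scale0r addr0; have [->|t0] := eqVneq (tau y) 0.
    by rewrite subr0 scale1r scale0r addr0 => /(H1 _ yr fy)/eqP; rewrite (negPf y0).
  (* Dividing by [tau y] brings the second hypothesis into play with [s = (1 - tau y) / tau y]. *)
  move/(congr1 (fun w => (tau y)^-1 *: w)); rewrite scalerDr !scalerA mulVf // scaler0 addrC.
  by rewrite -Phi_linear scale1r => /(H2 _ _ yr fy)/eqP; rewrite (negPf y0).
have [e e0 FK] := compact_perturb_neq0 cK
  (fun y Ky => conj (F0_continuous Ky.1) (F1_continuous Ky.1)) F0K.
have [y yr|y yr|y yr /= Fy] := @cube_zero R n r (fun y => F0 y + e *: F1 y) r0.
- have h := continuous_scalemx (@continuous_const_at _ _ e y) (F1_continuous yr).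
  exact: (continuous_addmx (F0_continuous yr) h).
- rewrite /F0 /F1 (tau_boundary yr) subrr !scale0r scaler0 addr0 add0r scale1r //.
have [ry|ry] := leP (r / 2) `|y|; first by have /eqP := FK y (conj yr ry).
have [_] := F_zero yr Fy; rewrite (tau_small (ltW ry)) subr0 scale1r scale0r addr0.
by move=> /(H3 _ _ yr) ez; rewrite ez ltxx in e0.
Qed.
End Core.

(** * Pluecker charts for fiber directions *)

Section Chart.
Variables (R : realType) (n k : nat).

Definition subst_col (f : 'I_k -> 'I_n) (i : 'I_k) (j : 'I_n) : {ffun 'I_k -> 'I_n} :=
  [ffun t => if t == i then j else f t].

(* By Cramer's rule the normalized basis matrix of a plane has quotients of
   Pluecker coordinates as entries. *)
Definition plucker_chart (f : 'I_k -> 'I_n)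
    (w : 'rV[R]_#|{: {ffun 'I_k -> 'I_n}}|) : 'M[R]_(k, n) :=
  \matrix_(i, j) (w 0 (enum_rank (subst_col f i j)) / w 0 (enum_rank [ffun t => f t])).

Lemma plucker_chart_continuous (T : topologicalType) f
    (F : T -> 'rV[R]_#|{: {ffun 'I_k -> 'I_n}}|) (x : T) :
  {for x, continuous F} -> F x 0 (enum_rank [ffun t => f t]) != 0 ->
  {for x, continuous (fun y => plucker_chart f (F y))}.
Proof.
move=> cF Fx; apply: continuous_mx => i j.
rewrite /prop_for /continuous_at mxE.
under eq_fun do rewrite mxE.
by apply: cvgM; [|apply: cvgV => //]; exact: continuous_entry.
Qed.

Lemma kvecE (B : 'M[R]_(k, n)) (g : {ffun 'I_k -> 'I_n}) :
  kvec B 0 (enum_rank g) = \det (colsub g B).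
Proof. by rewrite mxE enum_rankK. Qed.

Lemma odir_neq0 (B : 'M[R]_(k, n)) i : odir B 0 i != 0 -> kvec B 0 i != 0.
Proof. by rewrite mxE; apply: contra => /eqP ->; rewrite mulr0. Qed.

Lemma odir_coef_neq0 (B : 'M[R]_(k, n)) i : kvec B 0 i != 0 ->
  (Num.sqrt (\sum_i (kvec B 0 i) ^+ 2))^-1 != 0.
Proof.
move=> Bi; rewrite invr_eq0 gt_eqF // sqrtr_gt0 (bigD1 i) //=.
rewrite ltr_pwDl // ?sumr_ge0 // => [|j _]; last exact: sqr_ge0.
by rewrite lt_neqAle eq_sym sqrf_eq0 Bi sqr_ge0.
Qed.

Lemma plucker_chartE (f : 'I_k -> 'I_n) (B : 'M[R]_(k, n)) :
  colsub f B \in unitmx -> plucker_chart f (odir B) = invmx (colsub f B) *m B.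
Proof.
rewrite unitmxE unitfE => dB.
have kf : kvec B 0 (enum_rank [ffun t => f t]) = \det (colsub f B).
  by rewrite kvecE mxsub_ffunr.
have c0 : (Num.sqrt (\sum_i (kvec B 0 i) ^+ 2))^-1 != 0.
  by apply: (@odir_coef_neq0 _ (enum_rank [ffun t => f t])); rewrite kf.
apply/matrixP => i j; rewrite mxE /odir mxE [X in _ / X]mxE kf.
rewrite invfM mulrACA divff // mul1r kvecE.
rewrite /invmx unitmxE unitfE dB -scalemxAl mxE mulrC; congr (_ * _).
(* Expansion along the replaced column: its cofactors are those of [colsub f B], hence entries of
   the adjugate. *)
rewrite (expand_det_col _ i) mxE; apply: eq_bigr => s _.
rewrite !mxE ffunE eqxx mulrC; congr (_ * _).
rewrite /cofactor; congr (_ * \det _); apply/matrixP => a b; rewrite !mxE ffunE.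
by rewrite eq_sym (negPf (neq_lift _ _)).
Qed.
End Chart.

Lemma row_free_colsub_unit (F : fieldType) n k (B : 'M[F]_(k, n)) :
  row_free B -> exists f, colsub f B \in unitmx.
Proof.
move=> Bfree; have Bfull : row_full B^T by rewrite /row_full mxrank_tr.
exists (fullrankfun Bfull).
by rewrite -unitmx_tr trmx_mxsub fullrowsub_unit.
Qed.

Lemma chart_subP (F : fieldType) n k (B : 'M[F]_(k, n)) f (w : 'rV[F]_n) :
  colsub f B \in unitmx ->
  (w <= B)%MS <-> w - colsub f w *m (invmx (colsub f B) *m B) = 0.
Proof.
move=> uB; split=> [/submxP[u ->]|/eqP]; last first.
  by rewrite subr_eq0 mulmxA => /eqP ->; apply: submxMl.
by rewrite -mulmx_colsub !mulmxA mulmxK // subrr.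
Qed.

(** * Points of a fiber and global skewness *)

Section Points.
Variables (R : realType) (n k : nat) (B : 'M[R]_(k, n)) (a : 'rV[R]_n).

Lemma pts_translate z w : pts B a z -> (w <= B)%MS -> pts B a (z + w).
Proof.
move=> [u _ <-] /submxP[u' ->]; exists (u + u') => //.
by rewrite mulmxDl addrA.
Qed.

Lemma pts_sub z w : pts B a z -> pts B a w -> (z - w <= B)%MS.
Proof.
move=> [u _ <-] [u' _ <-].
by rewrite opprD addrACA subrr add0r -mulmxBl submxMl.
Qed.
End Points.

Theorem theorem1p2 (R : realType) (n k : nat)
    (fB : 'rV[R]_n -> 'M[R]_(k, n)) (fp : 'rV[R]_n -> 'rV[R]_n) :
  is_fibration [set: 'rV[R]_n] fB fp ->
  locally_skew fB fp ->
  skew_fibration [set: 'rV[R]_n] fB fp.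
Proof.
move=> [_ fiber disj odir_c _] loc p q _ _ npq.
pose F z := pts (fB z) (fp z).
have Fid z : F z z by have [] := fiber z I.
have same z w u : F z u -> F w u -> same_oplane (fB z) (fp z) (fB w) (fp w).
  by move=> zu wu; apply: disj => //; exists u.
split.
  by apply/seteqP; split=> // z [pz qz]; case: npq; apply: (same _ _ z).
move=> v vp vq; apply: contrapT => v0.
have [N [oN Np NP]] := loc p.
(* Near [p], local skewness leaves the fiber of [p] as the only one containing the direction [v]. *)
have NF y : N y -> (v <= fB y)%MS -> F p y.
  move=> Ny vy; apply: contrapT => npy; apply: v0; apply: (NP y p) vy vp.
  - by exists y; split=> //; apply: Fid.
  - by exists p; split=> //; apply: Fid.
  - by case=> e _; apply: npy; rewrite /F -e; apply: Fid.
have [f uf] : exists f, colsub f (fB p) \in unitmx.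
  by apply: row_free_colsub_unit; have [] := fiber p I.
pose i0 : 'I_#|{: {ffun 'I_k -> 'I_n}}| := enum_rank [ffun t => f t].
have kvec_f (B : 'M[R]_(k, n)) : kvec B 0 i0 = \det (colsub f B).
  by rewrite kvecE mxsub_ffunr.
have unit_f z : odir (fB z) 0 i0 != 0 -> colsub f (fB z) \in unitmx.
  by move/odir_neq0; rewrite kvec_f unitmxE unitfE.
have odirp : odir (fB p) 0 i0 != 0.
  have kp : kvec (fB p) 0 i0 != 0 by rewrite kvec_f -unitfE -unitmxE.
  by rewrite mxE mulf_neq0 // (odir_coef_neq0 kp).
have cod z : {for z, continuous (fun x => odir (fB x))}.
  exact: (continuous_subspace_setT _).2 odir_c z.
(* By continuity of [odir], the minor selected by [f] stays invertible for the fibers through points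
   near [p]. *)
have near_p : \forall y \near p, N y /\ odir (fB y) 0 i0 != 0.
  apply: filterI; first exact: open_nbhs_nbhs.
  have ce := continuous_entry (i := 0) (j := i0) (cod p).
  exact: (cvgr_neq0 _ ce odirp).
have [e /= e0 eP] := (nbhs_ballP _ _).1 near_p.
pose r := e / 2.
have r0 : 0 < r by rewrite divr_gt0.
have rP y : `|y| <= r -> N (p + y) /\ odir (fB (p + y)) 0 i0 != 0.
  move=> yr; apply: eP; rewrite -ball_normE /= opprD addNKr normrN.
  by rewrite (le_lt_trans yr) // ltr_pdivrMr // ltr_pMr //; lra.
pose A y := plucker_chart f (odir (fB (p + y))).
have AE y : `|y| <= r -> A y = invmx (colsub f (fB (p + y))) *m fB (p + y).
  by move=> /rP[_ /unit_f uy]; apply: plucker_chartE.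
have AP y (w : 'rV[R]_n) :
    `|y| <= r -> w - colsub f w *m A y = 0 -> (w <= fB (p + y)%R)%MS.
  by move=> yr; rewrite AE // => /chart_subP; apply; apply: unit_f; have [] := rP y yr.
(* Transversality: the slice through [p] meets the fiber of [p] only at [p]. *)
have Fp0 y : F p (p + y) -> colsub f y = 0 -> y = 0.
  move=> Fy fy; have := pts_sub Fy (Fid p); rewrite addrAC subrr add0r.
  by move=> /(chart_subP _ uf); rewrite fy mul0mx subr0.
apply: (@no_displacement R n k r f A v (p - q) r0).
- move=> y yr; apply: plucker_chart_continuous; last by have [] := rP y yr.
  apply: (@continuous_comp _ _ _ (fun y => p + y) (fun x => odir (fB x))); last exact: cod.
  have idc : {for y, continuous (fun y : 'rV[R]_n => y)} by exact: cvg_id.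
  exact: (continuous_addmx (@continuous_const_at _ _ p y) idc).
- move=> y yr; rewrite AE // -mulmx_colsub mulVmx //; apply: unit_f; by have [] := rP y yr.
- move=> y yr fy /(AP _ _ yr) vy; apply: Fp0 fy; apply: NF vy; by have [] := rP y yr.
- move=> y s yr fy /(AP _ _ yr) vy; apply: Fp0 fy.
  have [e' _] : same_oplane (fB (p + y)) (fp (p + y)) (fB p) (fp p).
    apply: (same _ _ (p - s *: v)).
      have -> : p - s *: v = p + y - (y + s *: v) by rewrite opprD addrA addrK.
      by apply: pts_translate; [exact: Fid | rewrite eqmx_opp].
    by apply: pts_translate; [exact: Fid | rewrite eqmx_opp scalemx_sub].
  by rewrite /F -e'; apply: Fid.
- move=> y s yr /(AP _ _ yr) vy; apply/eqP/negPn/negP => s0.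
  have sqy : same_oplane (fB q) (fp q) (fB (p + y)) (fp (p + y)).
    apply: (same _ _ (q - s^-1 *: v)).
      by apply: pts_translate; [exact: Fid | rewrite eqmx_opp scalemx_sub].
    have -> : q - s^-1 *: v = p + y - s^-1 *: (v + s *: (p - q + y)).
      rewrite scalerDr scalerA mulVf // scale1r; apply/rowP => c; rewrite !mxE; ring.
    by apply: pts_translate; [exact: Fid | rewrite eqmx_opp scalemx_sub].
  (* The fiber through [p + y] is that of [q], so it contains the direction [v]; being near [p], it
     is also that of [p], against [npq]. *)
  have Fq : F q (p + y) by rewrite /F sqy.1; apply: Fid.
  apply: npq; apply: (same _ _ (p + y)) => //; apply: NF; first by have [] := rP y yr.
  have -> : v = (q + v) - q by rewrite addrAC subrr add0r.
  have qF w : F q w -> F (p + y) w by rewrite /F sqy.1.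
  by apply: (@pts_sub _ _ _ _ (fp (p + y))); apply: qF; [apply: pts_translate => //|]; apply: Fid.
Qed.
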